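(* Let $\{x^k\}_{k\ge 0}$ be an infinite sequence generated by the nonmonotone generalized conditional gradient method described in the context, applied to $\min_{x\in\mathbb{E}} F(x)=f(x)+g(x)$. Then every accumulation point $x^*$ of $\{x^k\}$ is a stationary point of this problem, i.e. $x^*\in\operatorname{dom} g$ and $-\nabla f(x^* )\in\partial g(x^* )$.
   Context: Setting. $\mathbb{E}$ is a finite-dimensional real inner product space with inner product $\langle\cdot,\cdot\rangle$ and induced norm $\|\cdot\|$. For $\phi:\mathbb{E}\to(-\infty,\infty]$, $\operatorname{dom}\phi=\{x\mid\phi(x)<\infty\}$; $\phi$ is supercoercive if $\lim_{\|x\|\to\infty}\phi(x)/\|x\|=\infty$. Standing assumptions: $f:\mathbb{E}\to(-\infty,\infty]$ is lower semicontinuous and continuously differentiable on $\operatorname{dom} g$ (i.e. at each point of $\operatorname{dom} g$, $f$ is finite in a neighborhood and differentiable, and $\nabla f:\operatorname{dom} g\to\mathbb{E}$ is continuous); $g:\mathbb{E}\to(-\infty,\infty]$ is a proper closed convex function that is supercoercive; $F:=f+g$ is bounded from below. $\partial g$ is the convex subdifferential. Frank--Wolfe gap. For $x\in\operatorname{dom} g$, $G(x):=\max_{v\in\mathbb{E}}\{\langle\nabla f(x),x-v\rangle+g(x)-g(v)\}\ge 0$; the maximum is attained by supercoerciveness of $g$, exactly at the points of $\operatorname{argmin}_{v\in\mathbb{E}}\{\langle\nabla f(x),v\rangle+g(v)\}\neq\emptyset$. Nonmonotone generalized conditional gradient method. Input: $x^0\in\operatorname{dom} g$, $F_0=F(x^0)$,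 $0<\beta<1$, $0<\sigma<1$, $0<p\le 1$. For $k=0,1,2,\ldots$: choose any $v^k\in\operatorname{argmin}_{x\in\mathbb{E}}\{\langle\nabla f(x^k),x\rangle+g(x)\}$ and set $d^k=v^k-x^k$; let $i_k$ be the smallest $i\in\{0,1,2,\ldots\}$ such that $F(x^k+\beta^{i}d^k)\le F_k-\sigma\beta^{i}G(x^k)$; choose any $p_{k+1}\in[p,1]$; set $x^{k+1}=x^k+\beta^{i_k}d^k$ and $F_{k+1}=p_{k+1}F(x^{k+1})+(1-p_{k+1})F_k$. An infinite sequence generated by the method is one for which all these steps are carried out for every $k\ge0$ (in particular each $i_k$ exists). *)

(* Defs.v *)
From HB Require Import structures.
From mathcomp Require Import all_boot all_order all_algebra.
From mathcomp Require Import all_classical all_reals all_analysis.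
Import Order.TTheory GRing.Theory Num.Theory.
Import numFieldNormedType.Exports.

Set Implicit Arguments.
Unset Strict Implicit.
Unset Printing Implicit Defensive.

Local Open Scope classical_set_scope.
Local Open Scope ring_scope.

#[short(type="finNormedModType")]
HB.structure Definition FinNormedModule (R : numFieldType) :=
  {V of Vector R V & NormedModule R V}.

(* A real inner product is a form of type {dot E for idfun}; the norm carried
   by E, hence its topology, must be the induced one. *)
Definition norm_induced_by (R : realType) (E : normedModType R)
    (ip : {dot E for idfun}) : Prop :=
  forall x : E, `|x| = Num.sqrt (ip x x).

Section ExtendedRealFunctions.
Context {R : realType} {E : normedModType R}.
Implicit Types (phi : E -> \bar R) (x : E).
Local Open Scope ereal_scope.

Definition effective_domain phi : set E := [set x | phi x < +oo].

Definition proper_fun phi : Prop := (forall x, phi x != -oo) /\ effective_domain phi !=set0.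

(* Closed means that the epigraph is closed in E * R. *)
Definition closed_fun phi : Prop :=
  closed [set z : E * R | phi z.1 <= z.2%:E].

(* For phi never -oo; the sum is then always defined, and 0 * +oo = 0. *)
Definition convex_fun phi : Prop :=
  forall (x y : E) (t : R), (0 <= t <= 1)%R ->
    phi (t *: x + (1 - t) *: y)%R <= t%:E * phi x + (1 - t)%:E * phi y.

(* The filter of ||x|| -> oo. *)
Definition norm_infty : set_system E :=
  [set A | \forall r \near (+oo)%R, [set x : E | (r < `|x|)%R] `<=` A].

Definition supercoercive phi : Prop :=
  (fun x => phi x / `|x|%:E) @ norm_infty --> +oo.

Definition bounded_from_below phi : Prop :=
  exists m : R, forall x, m%:E <= phi x.

Definition argmin phi : set E := [set x | forall y, phi x <= phi y].

Variable ip : {dot E for idfun}.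

Definition subdifferential phi x : set E :=
  [set s | forall y, phi x + (ip s (y - x)%R)%:E <= phi y].

(* fine sends infinite values to 0; phi is required to be finite near x, so
   that the differential is that of phi itself. *)
Definition is_gradient phi x (s : E) : Prop :=
  [/\ \forall y \near x, phi y \is a fin_num,
      differentiable (fine \o phi) x &
      forall v : E, 'd (fine \o phi) x v = ip s v].

Definition continuously_differentiable_on (D : set E) phi
    (gradphi : E -> E) : Prop :=
  (forall x, D x -> is_gradient phi x (gradphi x)) /\
  {within D, continuous gradphi}.

End ExtendedRealFunctions.

Section ConditionalGradient.
Context {R : realType} {E : normedModType R}.
Variables (ip : {dot E for idfun}) (f g : E -> \bar R) (gradf : E -> E).
Local Open Scope ereal_scope.

Definition objective : E -> \bar R := fun x => f x + g x.

Definition linearized (x : E) : E -> \bar R :=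
  fun v => (ip (gradf x) v)%:E + g v.

(* The supremum is attained when g is supercoercive. *)
Definition FW_gap (x : E) : \bar R :=
  ereal_sup [set (ip (gradf x) (x - v)%R)%:E + g x - g v | v in [set: E]].

Definition stationary (x : E) : Prop :=
  effective_domain g x /\ subdifferential ip g x (- gradf x)%R.

Definition sufficient_decrease (beta sigma : R) (x d : E) (Fref : \bar R)
    (j : nat) : Prop :=
  objective (x + beta ^+ j *: d)%R
    <= Fref - (sigma * beta ^+ j)%:E * FW_gap x.

(* ls k is the line-search exponent i_k; Fref k is the reference value F_k,
   an element of \bar R that is finite along the iterations; the entry pk 0 is
   never used. *)
Record nonmonotone_GCG_run (beta sigma p : R) (x v : nat -> E)
    (ls : nat -> nat) (pk : nat -> R) (Fref : nat -> \bar R) : Prop := {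
  run_x0 : effective_domain g (x 0%N);
  run_F0 : Fref 0%N = objective (x 0%N);
  run_v : forall k, argmin (linearized (x k)) (v k);
  run_ls : forall k,
    sufficient_decrease beta sigma (x k) (v k - x k)%R (Fref k) (ls k);
  run_ls_min : forall k j, (j < ls k)%N ->
    ~ sufficient_decrease beta sigma (x k) (v k - x k)%R (Fref k) j;
  run_p : forall k, (p <= pk k.+1 <= 1)%R;
  run_xS : forall k, x k.+1 = (x k + beta ^+ ls k *: (v k - x k))%R;
  run_FS : forall k, Fref k.+1 =
    (pk k.+1)%:E * objective (x k.+1) + (1 - pk k.+1)%:E * Fref k
}.

End ConditionalGradient.

(* Main.v *)
(* The reference values F_k decrease by at least p sigma beta^(i_k) G(x^k) and
   are bounded below, so beta^(i_k) G(x^k) -> 0.  Lower semicontinuity of f and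
   g puts an accumulation point x* in dom g.  If x* were not stationary, then
   the gap would stay above some delta > 0 at the iterates near x*, so there
   the step beta^(i_k) is eventually small and the line search has rejected
   t = beta^(i_k - 1).  By convexity of g and the mean value theorem for f,
   this rejection gives a point z of the segment from x^k to x^k + t d^k with
     (1 - sigma) delta < <grad f(z) - grad f(x^k), d^k>.
   Supercoercivity bounds d^k, so both z and x^k are close to x*, which
   contradicts the continuity of grad f on dom g. *)
Require Import Defs.
From HB Require Import structures.
From mathcomp Require Import all_boot all_order all_algebra.
From mathcomp Require Import all_classical all_reals all_analysis.
From mathcomp Require Import ring lra.
Import Order.TTheory GRing.Theory Num.Theory.
Import numFieldNormedType.Exports.

Local Open Scope classical_set_scope.
Local Open Scope ring_scope.

Set Implicit Arguments.
Unset Strict Implicit.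

(** * Inner products, differentiation along lines, growth and sequences *)

Lemma dot_sym {R : realType} {E : lmodType R} (ip : {dot E for idfun}) u w :
  ip u w = ip w u.
Proof. by have := hermC ip u w; rewrite /= expr0 mul1r. Qed.

Lemma dot_CauchySchwarz {R : realType} {E : normedModType R}
    (ip : {dot E for idfun}) (u w : E) :
  norm_induced_by ip -> `|ip u w| <= `|u| * `|w|.
Proof.
move=> ipN.
have ip_ge0 z : 0 <= ip z z.
  have [->|z0] := eqVneq z 0; first by rewrite linear0r.
  by apply/ltW/neq0_dnorm_gt0.
rewrite !ipN -sqrtrM// -sqrtr_sqr ler_sqrt; last exact: mulr_ge0.
have [->|w0] := eqVneq w 0; first by rewrite !(linear0r ip) expr0n/= mulr0.
have w_gt0 : 0 < ip w w by exact: neq0_dnorm_gt0.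
(* The square of this vector expands to [c * (a * c - b ^+ 2)], and [0 < c] can then be
   cancelled. *)
have := ip_ge0 (ip w w *: u - ip u w *: w).
rewrite linearBl/= !linearBr/= !linearZl_LR/= !linearZr_LR/= (dot_sym ip w u).
set a := ip u u; set b := ip u w; set c := ip w w => h.
suff : 0 <= c * (a * c - b ^+ 2) by rewrite pmulr_rge0// subr_ge0.
by move: h; congr (_ <= _); rewrite -![_ *: _]/(_ * _); ring.
Qed.

(** One-variable mean value theorem along [s |-> x + s *: d], whose composite with [phi] is
    differentiated by the chain rule. *)
Lemma is_gradient_mean_value {R : realType} {E : normedModType R}
    (ip : {dot E for idfun}) (phi : E -> \bar R) (grad : E -> E)
    (x d : E) (t : R) :
  0 < t ->
  (forall s, 0 <= s <= t ->
    is_gradient ip phi (x + s *: d) (grad (x + s *: d))) ->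
  exists2 s, 0 < s < t &
    fine (phi (x + t *: d)) - fine (phi x) = t * ip (grad (x + s *: d)) d.
Proof.
move=> t0 gradphi.
pose l (s : R) := x + s *: d.
have dl s : is_diff s l (fun h : R => h *: d).
  rewrite /l; apply: is_diff_eq; apply/funext => h /=.
  by rewrite add0r.
have dphil s : 0 <= s <= t ->
    is_derive s (1 : R) (fine \o phi \o l) (ip (grad (l s)) d).
  move=> /gradphi[_ dphi dphiE].
  have dc : differentiable (fine \o phi \o l) s.
    apply: differentiable_comp => //.
  apply: DeriveDef; first exact/diff_derivable.
  rewrite deriveE// diff_comp//=.
  by rewrite diff_val dphiE scale1r.
have [|||s] := @MVT R (fine \o phi \o l) (fun s => ip (grad (l s)) d) 0 t.
- by [].
- move=> s; rewrite in_itv/= => /andP[s0 st]; apply: dphil.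
  by rewrite !ltW.
- apply: derivable_within_continuous => s; rewrite in_itv/= => /dphil[].
  by [].
rewrite in_itv/= => st; rewrite /l/= scale0r addr0 subr0 mulrC => e.
by exists s.
Qed.

Lemma supercoercive_ge_linear {R : realType} {E : normedModType R}
    (g : E -> \bar R) (M : R) :
  supercoercive g ->
  exists r : R, forall y : E, r < `|y| -> ((M * `|y|)%:E <= g y)%E.
Proof.
move=> /(_ _ (ereal_nbhs_pinfty_ge (num_real M)))[r [rR hr]].
(* The filter only grants radii strictly above [r], hence [r + 1]; the maximum with 0 makes [|y|]
   positive, so the quotient can be cleared. *)
exists (Num.max (r + 1) 0) => y; rewrite gt_max => /andP[ry y0].
have /= := hr (r + 1) _ y ry; rewrite ltrDl => /(_ ltr01).
by rewrite inver gt_eqF// lee_pdivlMr// EFinM.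
Qed.

(** If [a < g y], then [(y, a)] lies in the open complement of the epigraph; a product neighborhood
    there, sliced at height [a], gives the neighborhood of [y]. *)
Lemma closed_fun_lower_semicontinuous {R : realType} {E : normedModType R}
    (g : E -> \bar R) : closed_fun g -> lower_semicontinuous g.
Proof.
move=> clg y a ag.
have : open (~` [set z : E * R | (g z.1 <= z.2%:E)%E]) by exact: closed_openC.
rewrite openE => /(_ (y, a))[]/=; first by apply/negP; rewrite -ltNge.
move=> [A B] /= [yA aB] AB; exists A => // z Az.
rewrite ltNge; apply/negP; apply: (AB (z, a)); split => //=.
exact: nbhs_singleton.
Qed.

Lemma nonincreasing_bounded_steps (R : realType) (a : R^nat) (m e : R) :
  (forall k, a k.+1 <= a k) -> (forall k, m <= a k) -> 0 < e ->
  \forall k \near \oo, a k - a k.+1 < e.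
Proof.
move=> da ma e0.
have cva : cvgn a.
  apply: nonincreasing_is_cvgn; first exact/nonincreasing_seqP.
  by exists m => _ [k _ <-].
have cvS : a k.+1 @[k --> \oo] --> limn a.
  by rewrite (cvg_shiftS a).
have /cvgr0Pnorm_lt/(_ e e0) : (a k - a k.+1) @[k --> \oo] --> 0.
  by rewrite -(subrr (limn a)); apply: cvgB.
by apply: filterS => k; apply: le_lt_trans; exact: ler_norm.
Qed.

(** Replaces the extraction of subsequences: one suitable index suffices for each contradiction
    below. *)
Lemma cluster_frequently {T : topologicalType} (u : nat -> T) (l : T)
    (P : set nat) (B : set T) :
  cluster (u @ \oo) l -> (\forall k \near \oo, P k) -> nbhs l B ->
  exists2 k, P k & B (u k).
Proof.
move=> ul oP lB; have [|_ [[k Pk <-] Bu]] := ul (u @` P) B _ lB.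
  by apply: filterS oP => k Pk; exists k.
by exists k.
Qed.

(** * The real-valued gap and the line search on the domain of [g] *)

Section ConditionalGradientConvergence.
Context {R : realType} {E : normedModType R}.
Variables (ip : {dot E for idfun}) (f g : E -> \bar R) (gradf : E -> E).
Hypothesis f_C1 : continuously_differentiable_on ip (effective_domain g) f gradf.
Hypothesis g_proper : proper_fun g.
Hypothesis g_convex : convex_fun g.

(* Only meaningful on dom g, since fine sends infinite values to 0. *)
Definition fine_gap (y z : E) : R :=
  ip (gradf y) (y - z) + fine (g y) - fine (g z).

Definition fine_objective (y : E) : R := fine (f y) + fine (g y).

Let g_fineK y : effective_domain g y -> g y = (fine (g y))%:E.
Proof.
move=> gy; rewrite fineK// fin_numE g_proper.1 /=.
by move: gy; rewrite /effective_domain/= ltey.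
Qed.

Let f_fineK y : effective_domain g y -> f y = (fine (f y))%:E.
Proof.
by move=> /f_C1.1[/nbhs_singleton fy _ _]; rewrite fineK.
Qed.

Let objectiveE y : effective_domain g y ->
  objective f g y = (fine_objective y)%:E.
Proof. by move=> gy; rewrite /objective (f_fineK gy) (g_fineK gy) -EFinD. Qed.

Lemma convex_fun_segment (y z : E) (t : R) :
  effective_domain g y -> effective_domain g z -> 0 <= t <= 1 ->
  effective_domain g (y + t *: (z - y)) /\
  fine (g (y + t *: (z - y)))
    <= fine (g y) + t * (fine (g z) - fine (g y)).
Proof.
move=> gy gz t01.
have := g_convex z y t01.
have -> : t *: z + (1 - t) *: y = y + t *: (z - y).
  by rewrite scalerBl scalerBr scale1r addrCA.
rewrite (g_fineK gy) (g_fineK gz) -!EFinM -EFinD => gyz.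
have dyz : effective_domain g (y + t *: (z - y)).
  by apply: le_lt_trans gyz _; rewrite ltry.
split=> //; move: gyz; rewrite (g_fineK dyz) lee_fin /= => /le_trans; apply.
by rewrite le_eqVlt; apply/orP; left; apply/eqP; ring.
Qed.

(** Compare [z] with [y] itself, where the linearized objective is finite. *)
Lemma argmin_linearized_dom (y z : E) :
  effective_domain g y -> argmin (linearized ip g gradf y) z ->
  effective_domain g z.
Proof.
move=> gy /(_ y); rewrite /linearized (g_fineK gy) -EFinD /effective_domain/=.
by case: (g z) => [r||]; rewrite ?ltry ?ltNyr// addey// leye_eq.
Qed.

(** As a function of [w], [fine_gap y w] is a constant minus the linearized objective. *)
Lemma argmin_linearized_gap (y z w : E) :
  effective_domain g y -> argmin (linearized ip g gradf y) z ->
  effective_domain g w -> fine_gap y w <= fine_gap y z.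
Proof.
move=> gy zmin gw; have gz := argmin_linearized_dom gy zmin.
have := zmin w; rewrite /linearized (g_fineK gz) (g_fineK gw) -!EFinD lee_fin /=.
rewrite /fine_gap !linearBr/=; lra.
Qed.

(** Competitors outside the domain of [g] contribute [-oo] to the supremum, and [z] is the best of
    the others. *)
Lemma FW_gapE (y z : E) :
  effective_domain g y -> argmin (linearized ip g gradf y) z ->
  FW_gap ip g gradf y = (fine_gap y z)%:E.
Proof.
move=> gy zmin; have gz := argmin_linearized_dom gy zmin.
apply/eqP; rewrite eq_le; apply/andP; split; last first.
  apply: ereal_sup_ubound; exists z => //.
  by rewrite (g_fineK gy) (g_fineK gz).
apply: ge_ereal_sup => _ [w _ <-].
have [gw|gw] := pselect (effective_domain g w).
  rewrite (g_fineK gy) (g_fineK gw) lee_fin.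
  exact: argmin_linearized_gap.
have -> : g w = +oo%E.
  by apply/eqP; move: gw; rewrite /effective_domain/= ltey => /negP/negPn.
by rewrite (g_fineK gy) /= leNye.
Qed.

(** Divide the failed inequality by [t]: the increment of [f] becomes an inner product with the
    gradient at [s], that of [g] is at most [g z - g y], which equals
    [- fine_gap y z - ip (gradf y) (z - y)]. *)
Lemma linesearch_failure (sigma t : R) (y z : E) :
  effective_domain g y -> effective_domain g z -> 0 < t <= 1 ->
  fine_objective y - sigma * t * fine_gap y z
    < fine_objective (y + t *: (z - y)) ->
  exists2 s, 0 < s < t &
    effective_domain g (y + s *: (z - y)) /\
    (1 - sigma) * fine_gap y z
      < ip (gradf (y + s *: (z - y)) - gradf y) (z - y).
Proof.
move=> gy gz /andP[t0 t1] fail.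
have seg s : 0 <= s <= t -> effective_domain g (y + s *: (z - y)).
  by move=> /andP[s0 st]; apply: (convex_fun_segment gy gz _).1;
    rewrite s0 (le_trans st).
have [s st fs] : exists2 s, 0 < s < t &
    fine (f (y + t *: (z - y))) - fine (f y)
      = t * ip (gradf (y + s *: (z - y))) (z - y).
  by apply: is_gradient_mean_value => // s /seg /f_C1.1.
exists s => //; split; first by apply: seg; case/andP: st => /ltW -> /ltW ->.
have t01 : 0 <= t <= 1 by rewrite ltW.
have [_ gt] := convex_fun_segment gy gz t01.
rewrite -(ltr_pM2l t0).
move: fail fs gt; rewrite /fine_objective /fine_gap -(opprB z y) linearNr/=.
rewrite (linearBl ip)/=; set a := ip (gradf (_ + _)) _; set b := ip (gradf y) _.
move=> fail fs gt; lra.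
Qed.

(** * Invariants of the run and decrease of the reference values *)

Variables (beta sigma p m : R) (x v : nat -> E) (ls : nat -> nat).
Variables (pk : nat -> R) (Fref : nat -> \bar R).
Hypothesis F_ge : forall y, (m%:E <= objective f g y)%E.
Hypothesis beta01 : 0 < beta < 1.
Hypothesis sigma01 : 0 < sigma < 1.
Hypothesis p01 : 0 < p <= 1.
Hypothesis run : nonmonotone_GCG_run ip f g gradf beta sigma p x v ls pk Fref.

Let betaX_itv j : 0 < beta ^+ j <= 1.
Proof.
case/andP: beta01 => b0 b1.
by rewrite exprn_gt0//= exprn_ile1// ltW.
Qed.

Lemma sufficient_decreaseE (k j : nat) (c : R) :
  effective_domain g (x k) ->
  sufficient_decrease ip f g gradf beta sigma (x k) (v k - x k) c%:E j
  <-> fine_objective (x k + beta ^+ j *: (v k - x k))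
        <= c - sigma * beta ^+ j * fine_gap (x k) (v k).
Proof.
move=> gx; have gv := argmin_linearized_dom gx (run_v run k).
rewrite /sufficient_decrease (FW_gapE gx (run_v run k)) objectiveE.
  by rewrite -EFinM -EFinB lee_fin.
have /andP[b0 b1] := betaX_itv j.
by apply: (convex_fun_segment gx gv _).1; rewrite ltW.
Qed.

(** Take [x k] itself as competitor: its gap is 0. *)
Lemma run_gap_ge0 (k : nat) :
  effective_domain g (x k) -> 0 <= fine_gap (x k) (v k).
Proof.
move=> gx; have := argmin_linearized_gap gx (run_v run k) gx.
by rewrite {1}/fine_gap subrr linear0r add0r subrr.
Qed.

(** The three claims need a joint induction. The last one persists because [Fref k.+1] averages
    [Fref k] with the new objective value, which the line search puts below [Fref k]. *)
Lemma run_dom_reference (k : nat) :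
  [/\ effective_domain g (x k), Fref k = (fine (Fref k))%:E &
      fine_objective (x k) <= fine (Fref k)].
Proof.
elim: k => [|k [gx Fk Fxk]].
  by have gx := run_x0 run; rewrite (run_F0 run) (objectiveE gx).
have gv := argmin_linearized_dom gx (run_v run k).
have gxS : effective_domain g (x k.+1).
  have /andP[b0 b1] := betaX_itv (ls k).
  by rewrite (run_xS run); apply: (convex_fun_segment gx gv _).1; rewrite ltW.
have := run_ls run k; rewrite Fk sufficient_decreaseE// -(run_xS run) => dec.
split=> //; rewrite (run_FS run) Fk (objectiveE gxS) -!EFinM -EFinD//=.
have := run_gap_ge0 gx; have /andP[b0 b1] := betaX_itv (ls k).
case/andP: sigma01 => s0 s1; case/andP: (run_p run k) => pk0 pk1.
case/andP: p01 => p0 p1 gap0.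
have := mulr_ge0 (mulr_ge0 (ltW s0) (ltW b0)) gap0.
nra.
Qed.

(** The left factor [p] bounds [pk k.+1] from below: the difference of references is [pk k.+1] times
    [Fref k] minus the new objective value. *)
Lemma run_reference_decrease (k : nat) :
  p * (sigma * beta ^+ ls k * fine_gap (x k) (v k))
    <= fine (Fref k) - fine (Fref k.+1).
Proof.
have [gx Fk _] := run_dom_reference k.
have [gxS _ _] := run_dom_reference k.+1.
have := run_ls run k; rewrite Fk sufficient_decreaseE// -(run_xS run) => dec.
rewrite (run_FS run) Fk (objectiveE gxS) -!EFinM -EFinD/=.
have := run_gap_ge0 gx; have /andP[b0 b1] := betaX_itv (ls k).
case/andP: sigma01 => s0 s1; case/andP: (run_p run k) => pk0 pk1.
case/andP: p01 => p0 p1 gap0.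
have := mulr_ge0 (mulr_ge0 (ltW s0) (ltW b0)) gap0.
nra.
Qed.

Lemma run_reference_nonincreasing (k : nat) :
  fine (Fref k.+1) <= fine (Fref k).
Proof.
case/andP: p01 => p0 p1; case/andP: sigma01 => s0 s1.
rewrite -subr_ge0; apply: le_trans (run_reference_decrease k).
have [gx _ _] := run_dom_reference k.
have /andP[b0 b1] := betaX_itv (ls k).
apply: mulr_ge0; [exact: ltW|apply: mulr_ge0; last exact: run_gap_ge0].
by apply: mulr_ge0; exact: ltW.
Qed.

Lemma run_gap_step_cvg0 (e : R) : 0 < e ->
  \forall k \near \oo, beta ^+ ls k * fine_gap (x k) (v k) < e.
Proof.
case/andP: p01 => p0 p1; case/andP: sigma01 => s0 s1 e0.
have ps0 : 0 < p * sigma by exact: mulr_gt0.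
have m_le k : m <= fine (Fref k).
  have [gx _] := run_dom_reference k; apply: le_trans.
  by have := F_ge (x k); rewrite objectiveE// lee_fin.
have := nonincreasing_bounded_steps run_reference_nonincreasing m_le (mulr_gt0 e0 ps0).
apply: filterS => k.
move=> /(le_lt_trans (run_reference_decrease k)) h.
by rewrite -(ltr_pM2r ps0); move: h; congr (_ < _); ring.
Qed.

(** * Estimates near a point of the domain of [g] *)

(** Compare [v k] with [xstar] in the linearized problem: superlinear growth of [g] beats the linear
    term, whose slope is at most [M] near [xstar]. *)
Lemma run_directions_bounded (xstar : E) :
  norm_induced_by ip -> supercoercive g -> effective_domain g xstar ->
  exists2 D : R, 0 < D &
    forall k, `|xstar - x k| < 1 -> `|gradf xstar - gradf (x k)| < 1 ->
      `|v k - x k| <= D.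
Proof.
move=> ipN g_sc gxs.
pose M := `|gradf xstar| + 1.
(* Slope [M + 1] exceeds the gradient bound by one, which leaves [|v k| <= C] beyond radius [r]. *)
have [r rP] := supercoercive_ge_linear (M + 1) g_sc.
pose C := M * `|xstar| + fine (g xstar).
have norm_lt1 (a b : E) : `|a - b| < 1 -> `|b| <= `|a| + 1.
  move=> ab; rewrite -[in leLHS](subKr a b) (le_trans (ler_normB _ _))// lerD2l.
  exact: ltW.
exists (Num.max 0 (Num.max r C) + (`|xstar| + 1)).
  by rewrite ltr_wpDl ?le_max ?lexx// ltr_wpDl.
move=> k /norm_lt1 xk_le /norm_lt1 gradk_le.
rewrite (le_trans (ler_normB _ _))// lerD//.
suff : `|v k| <= Num.max r C by rewrite (le_max _ 0) => ->; rewrite orbT.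
rewrite le_max; case: leP => //= rv.
have [gx _ _] := run_dom_reference k.
have gv := argmin_linearized_dom gx (run_v run k).
have := run_v run k xstar; have := rP _ rv.
rewrite /linearized (g_fineK gv) (g_fineK gxs) -!EFinD !lee_fin => gvM vmin.
have ge_v : - (M * `|v k|) <= ip (gradf (x k)) (v k).
  rewrite lerNl (le_trans (ler_norm _))// normrN.
  by rewrite (le_trans (dot_CauchySchwarz _ _ ipN))// ler_wpM2r.
have le_xs : ip (gradf (x k)) xstar <= M * `|xstar|.
  rewrite (le_trans (ler_norm _))//.
  by rewrite (le_trans (dot_CauchySchwarz _ _ ipN))// ler_wpM2r.
rewrite /C; lra.
Qed.

Lemma near_dist_lt (xstar : E) (e : R) : 0 < e ->
  \forall z \near xstar, `|xstar - z| < e.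
Proof. by move=> e0; have := nbhsx_ballx xstar e e0; rewrite -ball_normE. Qed.

Lemma gradient_near (xstar : E) (e : R) : effective_domain g xstar -> 0 < e ->
  \forall z \near xstar, effective_domain g z -> `|gradf xstar - gradf z| < e.
Proof.
move=> gxs e0.
have /subspace_continuousP/(_ _ gxs)/cvgrPdist_lt/(_ e e0) := f_C1.2.
by [].
Qed.

Lemma fine_gap_lower_semicontinuous (xstar y : E) (c : R) :
  norm_induced_by ip -> lower_semicontinuous g ->
  effective_domain g xstar -> c < fine_gap xstar y ->
  \forall z \near xstar, effective_domain g z -> c < fine_gap z y.
Proof.
move=> ipN g_lsc gxs cgap.
(* One third of the slack for each loss: the change of gradient, paired with [z - y]; the
   displacement [xstar - z], paired with [gradf xstar]; the drop of [g]. *)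
pose e := (fine_gap xstar y - c) / 3.
have e0 : 0 < e by rewrite divr_gt0// subr_gt0.
have e3 : fine_gap xstar y = c + 3 * e by rewrite /e; field.
pose K := `|xstar - y| + 1.
have K0 : 0 < K by rewrite ltr_wpDl.
pose N := `|gradf xstar| + 1.
have N0 : 0 < N by rewrite ltr_wpDl.
have [V xsV gV] : exists2 V, nbhs xstar V &
    forall z, V z -> ((fine (g xstar) - e)%:E < g z)%E.
  by apply: g_lsc; rewrite (g_fineK gxs) lte_fin gtrBl.
near=> z => gz.
have gz_lt : fine (g xstar) - e < fine (g z).
  by rewrite -lte_fin -g_fineK//; apply: gV; near: z.
have grad_lt : `|gradf xstar - gradf z| < e / K.
  by move: gz; near: z; apply: gradient_near => //; rewrite divr_gt0.
have z_lt : `|xstar - z| < e / N.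
  by near: z; apply: near_dist_lt; rewrite divr_gt0.
have z_lt1 : `|xstar - z| < 1 by near: z; exact: near_dist_lt.
have zy_lt : `|z - y| < K.
  rewrite -(subrKA xstar) (le_lt_trans (ler_normD _ _))// addrC ltrD2l.
  by rewrite distrC.
have grad_dot : ip (gradf xstar - gradf z) (z - y) <= e.
  rewrite (le_trans (ler_norm _))// (le_trans (dot_CauchySchwarz _ _ ipN))//.
  by rewrite -(divfK (lt0r_neq0 K0) e) ler_pM// ltW.
have dot_z : ip (gradf xstar) (xstar - z) <= e.
  rewrite (le_trans (ler_norm _))// (le_trans (dot_CauchySchwarz _ _ ipN))//.
  by rewrite mulrC -(divfK (lt0r_neq0 N0) e) ler_pM// ?ltW// ltr_pwDr.
move: e3 grad_dot dot_z; rewrite /fine_gap (linearBl ip)/= !(linearBr ip)/=.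
lra.
Unshelve. all: by end_near.
Qed.

(** * Accumulation points of the iterates *)

(** If [g xstar] were infinite, some iterate near [xstar] would have [f] above [c] and [g] above
    [Fref 0 - c], although objective values never exceed [Fref 0]. *)
Lemma cluster_point_dom (xstar : E) :
  (forall y, f y != -oo%E) ->
  lower_semicontinuous f -> lower_semicontinuous g ->
  cluster (x @ \oo) xstar -> effective_domain g xstar.
Proof.
move=> fNy f_lsc g_lsc xs_cl.
have Fref_le k : fine (Fref k) <= fine (Fref 0).
  elim: k => // k; apply: le_trans; exact: run_reference_nonincreasing.
rewrite /effective_domain/=; apply: contrapT => /negP.
rewrite -leNgt leye_eq => /eqP gxs.
have [c cf] : exists c : R, (c%:E < f xstar)%E.
  case: (f xstar) (fNy xstar) => [r| |]// _; last by exists 0; rewrite ltry.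
  by exists (r - 1); rewrite lte_fin gtrBl.
have [V xsV fV] := f_lsc _ _ cf.
have [W xsW gW] : exists2 W, nbhs xstar W &
    forall z, W z -> ((fine (Fref 0) - c)%:E < g z)%E.
  by apply: g_lsc; rewrite gxs ltry.
have [k _ [/fV + /gW]] := cluster_frequently xs_cl filterT (filterI xsV xsW).
have [gx _ Fx] := run_dom_reference k.
rewrite (f_fineK gx) (g_fineK gx) !lte_fin.
by have := le_trans Fx (Fref_le k); rewrite /fine_objective; lra.
Qed.

Lemma cluster_point_stationary (xstar : E) :
  norm_induced_by ip -> (forall y, f y != -oo%E) ->
  lower_semicontinuous f -> lower_semicontinuous g -> supercoercive g ->
  cluster (x @ \oo) xstar -> stationary ip g gradf xstar.
Proof.
move=> ipN fNy f_lsc g_lsc g_sc xs_cl.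
have gxs := cluster_point_dom fNy f_lsc g_lsc xs_cl.
split=> // y.
have [gy|/negP] := pselect (effective_domain g y); last first.
  by rewrite -leNgt leye_eq => /eqP ->; rewrite leey.
(* On the domain of [g] the subgradient inequality at [y] says [fine_gap xstar y <= 0]. *)
rewrite (g_fineK gxs) (g_fineK gy) -EFinD lee_fin linearNl/= -linearNr/= opprB.
rewrite addrC -subr_le0 -/(fine_gap xstar y).
rewrite leNgt; apply/negP => gap_gt0.
pose delta := fine_gap xstar y / 2.
have delta0 : 0 < delta by rewrite divr_gt0.
have delta_lt : delta < fine_gap xstar y by rewrite /delta; lra.
have [D D0 vD] := run_directions_bounded ipN g_sc gxs.
case/andP: sigma01 => s0 s1; case/andP: beta01 => b0 b1.
(* Chosen so that two gradient errors [eta] against a direction of length [D] add up to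
   [(1 - sigma) * delta]. *)
pose eta := (1 - sigma) * delta / (2 * D).
have eta0 : 0 < eta by rewrite divr_gt0 ?mulr_gt0// subr_gt0.
have /nbhs_ballP[e /= e0 grad_e] := gradient_near gxs eta0.
(* The bound 1 excludes [ls k = 0]; the factor [beta] passes from the accepted step to the rejected
   one, which is larger by [1 / beta]. *)
pose tau := Num.min 1 (beta * (e / (2 * D))).
have tau0 : 0 < tau by rewrite lt_min ltr01/= mulr_gt0// divr_gt0// mulr_gt0.
have taud0 : 0 < tau * delta by exact: mulr_gt0.
have [k /= step_lt [[xk_e2 xk1] [gap_k grad1]]] :=
  cluster_frequently xs_cl (run_gap_step_cvg0 taud0)
    (filterI (filterI (near_dist_lt xstar (divr_gt0 e0 (ltr0Sn R 1)))
                      (near_dist_lt xstar ltr01))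
             (filterI (fine_gap_lower_semicontinuous ipN g_lsc gxs delta_lt)
                      (gradient_near gxs ltr01))).
have [gx Fk Fxk] := run_dom_reference k.
have gv := argmin_linearized_dom gx (run_v run k).
(* The fixed competitor [y] already has gap above [delta] at [x k], and [v k] maximizes the gap. *)
have gap_gt : delta < fine_gap (x k) (v k).
  by rewrite (lt_le_trans (gap_k gx))// argmin_linearized_gap//; exact: run_v run k.
have {vD} vD := vD k xk1 (grad1 gx).
have step_tau : beta ^+ ls k < tau.
  rewrite -(ltr_pM2r delta0); apply: le_lt_trans step_lt.
  have /andP[bk0 _] := betaX_itv (ls k).
  by rewrite ler_pM2l// ltW.
have [j lsj] : exists j, ls k = j.+1.
  case: (ls k) step_tau => [|j _]; last by exists j.
  by rewrite expr0 lt_min ltxx.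
have step_small : beta ^+ j * D < e / 2.
  move: step_tau; rewrite lsj exprS lt_min => /andP[_]; rewrite ltr_pM2l//.
  by rewrite invfM mulrA ltr_pdivlMr.
have fail : fine_objective (x k) - sigma * beta ^+ j * fine_gap (x k) (v k)
    < fine_objective (x k + beta ^+ j *: (v k - x k)).
  rewrite ltNge; apply/negP => dec.
  have /(run_ls_min run)[] : (j < ls k)%N by rewrite lsj.
  by rewrite Fk sufficient_decreaseE// (le_trans dec)// lerD2r.
have [s /andP[s_gt0 sj] [gz gap_lt]] :=
  linesearch_failure gx gv (betaX_itv j) fail.
set z := x k + s *: (v k - x k) in gz gap_lt.
have zxk : `|x k - z| < e / 2.
  rewrite opprD addNKr normrN normrZ gtr0_norm//.
  apply: le_lt_trans step_small.
  by rewrite ler_pM// ltW.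
have z_e : `|xstar - z| < e.
  by rewrite -(subrKA (x k)) (le_lt_trans (ler_normD _ _))// [ltRHS]splitr ltrD.
have xk_e : `|xstar - x k| < e.
  by rewrite (lt_trans xk_e2)// gtr_pMr// invf_lt1// ltr1n.
have grad_z : `|gradf xstar - gradf z| < eta.
  by apply: grad_e gz; rewrite -ball_normE.
have grad_xk : `|gradf xstar - gradf (x k)| < eta.
  by apply: grad_e gx; rewrite -ball_normE.
(* Passing through [gradf xstar] costs [eta] twice; the resulting bound contradicts [gap_lt]. *)
have : ip (gradf z - gradf (x k)) (v k - x k) <= 2 * eta * D.
  rewrite (le_trans (ler_norm _))// (le_trans (dot_CauchySchwarz _ _ ipN))//.
  rewrite ler_pM// -(subrKA (gradf xstar)) (le_trans (ler_normD _ _))//.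
  by rewrite (distrC (gradf z)) mulr_natl mulr2n lerD// ltW.
have -> : 2 * eta * D = (1 - sigma) * delta.
  by rewrite /eta; field; rewrite gt_eqF.
apply/negP; rewrite -ltNge; apply: lt_trans gap_lt.
by rewrite ltr_pM2l// subr_gt0.
Qed.

End ConditionalGradientConvergence.

Unset Implicit Arguments.

Theorem theorem3p1 (R : realType) (E : finNormedModType R)
    (ip : {dot E for idfun}) (f g : E -> \bar R) (gradf : E -> E)
    (beta sigma p : R) (x v : nat -> E) (ls : nat -> nat) (pk : nat -> R)
    (Fref : nat -> \bar R) (xstar : E) :
  norm_induced_by ip ->
  (forall y, f y != -oo%E) ->
  lower_semicontinuous f ->
  continuously_differentiable_on ip (effective_domain g) f gradf ->
  proper_fun g -> closed_fun g -> convex_fun g -> supercoercive g ->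
  bounded_from_below (objective f g) ->
  0 < beta < 1 -> 0 < sigma < 1 -> 0 < p <= 1 ->
  nonmonotone_GCG_run ip f g gradf beta sigma p x v ls pk Fref ->
  cluster (x @ \oo) xstar ->
  stationary ip g gradf xstar.
Proof.
move=> ipN fNy f_lsc f_C1 g_proper g_closed g_convex g_sc [m F_ge].
move=> beta01 sigma01 p01 run.
apply: (cluster_point_stationary f_C1 g_proper g_convex F_ge beta01 sigma01 p01
  run ipN fNy f_lsc _ g_sc).
exact: closed_fun_lower_semicontinuous.
Qed.
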